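(* Let $X$ be an infinite dimensional real normed linear space, and let $A\subset X$ be a nonempty open convex set. (a) There exists a positive d.c. function $f$ on $A$ such that $1/f$ is not d.c. on $A$. (b) There exists a locally d.c. function $g$ on $A$ which is not d.c. on $A$.
   Context: A function $f\colon C\to\mathbb{R}$ on a convex subset $C$ of a real normed linear space is called d.c. (delta-convex) if it is the difference of two continuous convex functions on $C$. It is locally d.c. on $C$ if each $c\in C$ has a convex neighbourhood $U$ such that $f$ is d.c. on $U\cap C$. ''Positive'' means $f(x)>0$ for all $x\in A$. *)

(* Defs.v *)
From HB Require Import structures.
From mathcomp Require Import all_boot all_order all_algebra.
From mathcomp Require Import all_classical all_reals all_analysis.

Set Implicit Arguments.
Unset Strict Implicit.
Unset Printing Implicit Defensive.

Import Order.TTheory GRing.Theory Num.Theory.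
Import numFieldNormedType.Exports.

Local Open Scope classical_set_scope.
Local Open Scope ring_scope.

Definition infinite_dimensional (R : realType) (X : lmodType R) : Prop :=
  ~ exists (n : nat) (b : 'I_n -> X),
      forall x : X, exists a : 'I_n -> R, x = \sum_(i < n) a i *: b i.

(* Functions on C are represented by total functions on X; every clause below
   depends only on the values on C. In particular {within C, continuous g} is
   continuity for the topology induced on C, not continuity in X at the points
   of C. These notions are meant for convex C. *)
Definition dc_on (R : realType) (X : normedModType R) (C : set X)
    (f : X -> R) : Prop :=
  exists g h : X -> R,
    [/\ @convex_function R X C g /\ {within C, continuous g},
        @convex_function R X C h /\ {within C, continuous h} &
        forall x : X, C x -> f x = g x - h x].

Definition locally_dc_on (R : realType) (X : normedModType R) (C : set X)
    (f : X -> R) : Prop :=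
  forall c : X, C c ->
    exists U : set X, [/\ @convex_set R X U, nbhs c U & dc_on (U `&` C) f].

(* Main.v *)
(** Let [V_k] be an increasing sequence of finite-dimensional subspaces and
    [z_k \in V_(k+1)] an almost unit vector at distance 1 from [V_k] (Riesz);
    write [d_k] for the distance to [V_k].  With [u_k = 4^-k / 8] put
      [N = dist(., \bigcup V_k)
           + sup_k ((2 - 8 u_k) d_k + 2 u_k max (d_(k+1), u_k / 2 |.|))],
      [S = sup_(k < j) (1 - u_j) ((2 - 8 u_k) d_k + 2 u_k d_j)].
    These are continuous seminorms with [S < N] off 0, but [N - S] tends to 0
    along [z_k + u_k z_j] as [j] tends to infinity, for each fixed [k].  The
    function [f] of (a) is [N - S] up to a translation and a correction near the
    origin making it positive there.  If [1 / f = g - h], then [g] is bounded on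
    some ball around the origin, hence, by convexity, on the points
    [z_k + u_k z_j] for [k] large and fixed, while [h] is bounded below there: a
    contradiction.  The same [1 / f] is locally d.c., because [f] is locally
    bounded away from 0. *)
Require Import Defs.
From HB Require Import structures.
From mathcomp Require Import all_boot all_order all_algebra.
From mathcomp Require Import all_classical all_reals all_analysis.
From mathcomp Require Import ring lra.

Import Order.TTheory GRing.Theory Num.Theory.
Import numFieldNormedType.Exports.

Local Open Scope classical_set_scope.
Local Open Scope ring_scope.

(** * Seminorms dominated by a multiple of the norm, and their suprema *)

Section BoundedSeminorms.
Context {R : realType} {X : normedModType R}.
Implicit Types (p q : X -> R) (C : R) (x y : X).

(** Homogeneity is stated as an inequality, which passes to suprema; [seminormZ] recovers equality.
    A constant [C] common to a family makes its supremum finite. *)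
Definition bounded_seminorm C p :=
  [/\ forall x y, p (x + y) <= p x + p y,
      forall t x, p (t *: x) <= `|t| * p x
    & forall x, p x <= C * `|x|].

Lemma seminormN {C p} x : bounded_seminorm C p -> p (- x) = p x.
Proof.
move=> [_ pZ _]; have pN y : p (- y) <= p y.
  by have := pZ (-1) y; rewrite scaleN1r normrN1 mul1r.
by apply/le_anti; rewrite pN -{1}(opprK x) pN.
Qed.

Lemma seminorm_ge0 {C p} x : bounded_seminorm C p -> 0 <= p x.
Proof.
move=> hp; have [pD pZ _] := hp.
have := pD 0 0; have := pD x (- x).
by rewrite (seminormN _ hp) subrr addr0; lra.
Qed.

Lemma seminormZ {C p} t x : bounded_seminorm C p -> p (t *: x) = `|t| * p x.
Proof.
move=> hp; have [pD pZ _] := hp; apply/le_anti; rewrite pZ /=.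
have [->|t0] := eqVneq t 0.
  by rewrite normr0 mul0r; apply: seminorm_ge0 hp.
rewrite -ler_pdivlMl ?normr_gt0// -normfV.
by have := pZ t^-1 (t *: x); rewrite scalerA mulVf// scale1r.
Qed.

Lemma seminormB {C p} x y : bounded_seminorm C p -> p x - C * `|y| <= p (x + y).
Proof.
move=> hp; have [pD _ pC] := hp.
have := pD (x + y) (- y); rewrite addrK (seminormN _ hp).
by have := pC y; lra.
Qed.

Lemma seminorm_dist {C p} x y : bounded_seminorm C p ->
  `|p x - p y| <= C * `|x - y|.
Proof.
move=> hp; have [pD _ pC] := hp.
have h1 := pD (x - y) y; have h2 := pD (y - x) x; rewrite !subrK in h1 h2.
have := pC (x - y); rewrite ler_norml.
by move: h2; rewrite -(opprB x y) (seminormN _ hp) => *; apply/andP; split; lra.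
Qed.

Lemma seminorm_norm : bounded_seminorm 1 (fun x : X => `|x|).
Proof.
by split=> *; rewrite ?mul1r ?normrZ ?ler_normD.
Qed.

Lemma seminormD {C1 C2 p q} : bounded_seminorm C1 p -> bounded_seminorm C2 q ->
  bounded_seminorm (C1 + C2) (fun x => p x + q x).
Proof.
move=> [pD pZ pC] [qD qZ qC]; split=> [x y|t x|x].
- by have := pD x y; have := qD x y; lra.
- by rewrite mulrDr lerD.
- by rewrite mulrDl lerD.
Qed.

Lemma seminormM {C p} c : 0 <= c -> bounded_seminorm C p ->
  bounded_seminorm (c * C) (fun x => c * p x).
Proof.
move=> c0 [pD pZ pC]; split=> [x y|t x|x].
- by rewrite -mulrDr ler_wpM2l.
- by rewrite mulrCA ler_wpM2l.
- by rewrite -mulrA ler_wpM2l.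
Qed.

Lemma seminorm_max {C p q} : bounded_seminorm C p -> bounded_seminorm C q ->
  bounded_seminorm C (fun x => Num.max (p x) (q x)).
Proof.
move=> [pD pZ pC] [qD qZ qC]; split=> [x y|t x|x]; rewrite ge_max.
- rewrite (le_trans (pD x y)) ?(le_trans (qD x y))//.
    by apply: lerD; rewrite le_max lexx ?orbT.
  by apply: lerD; rewrite le_max lexx ?orbT.
- rewrite (le_trans (pZ t x)) ?(le_trans (qZ t x))//.
    by rewrite ler_wpM2l// le_max lexx ?orbT.
  by rewrite ler_wpM2l// le_max lexx ?orbT.
- by rewrite pC qC.
Qed.

Lemma seminorm_le {C C' p} : C <= C' -> bounded_seminorm C p ->
  bounded_seminorm C' p.
Proof.
move=> CC' [pD pZ pC]; split=> // x.
by rewrite (le_trans (pC x))// ler_wpM2r.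
Qed.

Definition supf {I : Type} (F : I -> X -> R) x : R := sup (range (F^~ x)).

Lemma supf_ge {I : Type} {F : I -> X -> R} {C} i x :
  (forall i, bounded_seminorm C (F i)) -> F i x <= supf F x.
Proof.
move=> hF; apply: ub_le_sup; last by exists i.
by exists (C * `|x|) => _ [j _ <-]; have [_ _ ->] := hF j.
Qed.

(** The point of [I] makes the range nonempty; [sup] of an empty range would be the default [0]. *)
Lemma supf_le {I : pointedType} (F : I -> X -> R) x M :
  (forall i, F i x <= M) -> supf F x <= M.
Proof.
move=> hF; apply: ge_sup; first by exists (F point x), point.
by move=> _ [j _ <-].
Qed.

Lemma seminorm_supf {I : pointedType} {F : I -> X -> R} {C} :
  (forall i, bounded_seminorm C (F i)) -> bounded_seminorm C (supf F).
Proof.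
move=> hF; split=> [x y|t x|x]; apply: supf_le => i; have [FD FZ FC] := hF i.
- by rewrite (le_trans (FD x y))// lerD//; apply: supf_ge hF.
- by rewrite (le_trans (FZ t x))// ler_wpM2l//; apply: supf_ge hF.
- exact: FC.
Qed.

End BoundedSeminorms.

(** * Distance to a subspace, closedness of finite spans, Riesz vectors *)

Section DistanceToSubspace.
Context {R : realType} {X : normedModType R}.
Implicit Types (W : set X) (x y z : X) (s : seq X).

Definition linear_subspace W :=
  W 0 /\ forall t x y, W x -> W y -> W (t *: x + y).

Definition dist W x : R := inf [set `|x - w| | w in W].

Lemma dist_le W x w : W w -> dist W x <= `|x - w|.
Proof.
move=> Ww; apply: ge_inf; last by exists w.
by exists 0 => _ [v _ <-].
Qed.

Lemma dist_adherent W x e : W 0 -> 0 < e ->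
  exists2 w, W w & `|x - w| < dist W x + e.
Proof.
move=> W0 e0.
have [|_ [w Ww <-] xw] := @inf_adherent _ [set `|x - w| | w in W] _ e0.
  by split; [exists `|x - 0|, 0 | exists 0 => _ [v _ <-]].
by exists w.
Qed.

Lemma seminorm_dist_subspace W : linear_subspace W ->
  bounded_seminorm 1 (dist W).
Proof.
move=> [W0 WL]; split=> [x y|t x|x]; last first.
- by rewrite mul1r (le_trans (dist_le W x 0 W0))// subr0.
- apply/ler_addgt0Pr => e e0.
  (* Dividing by [|t| + 1] rather than [|t|] covers [t = 0]. *)
  have t1 : 0 < `|t| + 1 by rewrite ltr_wpDl.
  have [w Ww xw] := dist_adherent W x (e / (`|t| + 1)) W0 (divr_gt0 e0 t1).
  apply: le_trans (dist_le W (t *: x) (t *: w) _) _.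
    by rewrite -[t *: w]addr0; apply: WL.
  rewrite -scalerBr normrZ.
  apply: (@le_trans _ _ (`|t| * (dist W x + e / (`|t| + 1)))).
    by rewrite ler_wpM2l// ltW.
  rewrite mulrDr lerD2l mulrCA ler_piMr ?ltW// ltr_pdivrMr//; lra.
- apply/ler_addgt0Pr => e e0.
  have e2 : 0 < e / 2 by rewrite divr_gt0.
  have [v Wv xv] := dist_adherent W x _ W0 e2.
  have [w Ww yw] := dist_adherent W y _ W0 e2.
  apply: le_trans (dist_le W _ (v + w) _) _.
    by rewrite -[v]scale1r; apply: WL.
  have := ler_normD (x - v) (y - w); rewrite addrACA -opprD; lra.
Qed.

Lemma dist_mem W x : linear_subspace W -> W x -> dist W x = 0.
Proof.
move=> hW Wx; apply/le_anti; rewrite (seminorm_ge0 _ (seminorm_dist_subspace W hW)).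
by rewrite (le_trans (dist_le W x x Wx))// subrr normr0.
Qed.

(** Adding one vector at a time lets closedness be proved by induction on the list. *)
Fixpoint lspan s : set X :=
  if s is z :: s' then [set x | exists t, lspan s' (x - t *: z)] else [set 0].

Lemma lspan_subspace s : linear_subspace (lspan s).
Proof.
elim: s => [|z s [s0 sL]] /=.
  by split=> // t x y -> ->; rewrite scaler0 addr0.
split; first by exists 0; rewrite scale0r subr0.
move=> t x y [a xa] [b yb]; exists (t * a + b).
suff -> : t *: x + y - (t * a + b) *: z = t *: (x - a *: z) + (y - b *: z).
  exact: sL.
by rewrite scalerBr scalerA scalerDl opprD addrACA.
Qed.

Lemma lspan_coord s x : lspan s x ->
  exists a : nat -> R, x = \sum_(i < size s) a i *: nth 0 s i.
Proof.
elim: s x => [x -> | z s IH x [t /IH[a xa]]] /=.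
  by exists (fun=> 0); rewrite big_ord0.
exists (fun i => if i is j.+1 then a j else t).
by rewrite big_ord_recl /= -xa addrC subrK.
Qed.

(* The distance from [x - t *: z] to [lspan s] tends to infinity with [`|t|],
   hence attains its infimum over [t]. *)
Lemma lspan_closed s x : dist (lspan s) x = 0 -> lspan s x.
Proof.
elim: s x => [x|z s IH x] /=.
  move=> x0; apply/eqP; rewrite -normr_le0; apply/ler_addgt0Pr => e e0.
  have [w -> ] := @dist_adherent [set 0] x e erefl e0.
  by rewrite subr0 x0 => /ltW.
have [sz|nsz] := pselect (lspan s z).
  move=> x0; exists 0; rewrite scale0r subr0; apply: IH.
  rewrite -x0; congr (inf _); apply/seteqP; split=> r [w] /=.
    by move=> sw <-; exists w => //; exists 0; rewrite scale0r subr0.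
  move=> [t stw] <-; exists w => //; clear -stw sz.
  rewrite -(subrK (t *: z) w) addrC; have [_ sL] := lspan_subspace s.
  exact: sL.
move=> x0; set p := dist (lspan s).
have hp : bounded_seminorm 1 p by apply/seminorm_dist_subspace/lspan_subspace.
have [pD pZ pC] := hp.
have pz : 0 < p z.
  rewrite lt_neqAle (seminorm_ge0 _ hp) andbT eq_sym.
  by apply/eqP => /IH.
(* If [p (x - t *: z) <= 1], then [|t| * p z <= |x| + 1], so [t] lies in [[-M, M]] and a minimum
   over this compact interval suffices. *)
pose M := (`|x| + 1) / p z.
have M0 : 0 <= M by rewrite divr_ge0 ?ltW// ltr_wpDl.
have cont : continuous (fun t : R => p (x - t *: z)).
  move=> t; apply/cvgrPdist_le => e e0.
  have z1 : 0 < `|z| + 1 by rewrite ltr_wpDl.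
  near=> u; apply: le_trans (seminorm_dist _ _ hp) _.
  rewrite mul1r opprB addrC addrA subrK -scalerBl normrZ.
  apply: (@le_trans _ _ (`|u - t| * (`|z| + 1))); first by rewrite ler_wpM2l// lerDl.
  rewrite -ler_pdivlMr// distrC; near: u.
  by apply: cvgr_dist_le; rewrite ?divr_gt0//; exact: cvg_id.
have [//||c _ cmin] := @EVT_min R (fun t => p (x - t *: z)) (- M) M.
- by rewrite ge0_cp.
- by apply: continuous_subspaceT => t; exact: cont.
exists c; apply: IH; apply/le_anti; rewrite (seminorm_ge0 _ hp) andbT.
apply/ler_addgt0Pr => e e0; rewrite add0r.
(* The bound [e] makes the minimum small; the bound [1] keeps the competitor [t] in [[-M, M]]. *)
have e1 : 0 < Num.min e 1 by rewrite lt_min e0 ltr01.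
have [w [t wt]] := @dist_adherent _ x (Num.min e 1) (lspan_subspace (z :: s)).1 e1.
rewrite [dist _ _]x0 add0r lt_min => /andP[we w1].
have xt : p (x - t *: z) <= `|x - w|.
  have -> : x - w = (x - t *: z) - (w - t *: z) by rewrite opprB addrA subrK.
  exact: dist_le.
apply: le_trans (cmin t _) (le_trans xt (ltW we)).
have : `|t| * p z <= `|x| + 1.
  rewrite -(seminormZ _ _ hp).
  have := seminormB x (- (x - t *: z)) hp.
  have := pD x (- (x - t *: z)); rewrite (seminormN _ hp).
  rewrite opprB addrC subrK; have := pC x; lra.
by rewrite -ler_pdivlMr// in_itv/= ler_norml.
Unshelve. all: by end_near.
Qed.

(** Subtract from a vector outside the span an almost nearest point of the span, which leaves the
    distance unchanged, and divide by that distance; it is positive because the span is closed. *)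
Lemma riesz_lspan s e : infinite_dimensional X -> 0 < e ->
  exists2 z, dist (lspan s) z = 1 & `|z| <= 1 + e.
Proof.
move=> hX e0; have hW := lspan_subspace s.
have hp := seminorm_dist_subspace _ hW; have [pD pZ pC] := hp.
have [x nx] : exists x, ~ lspan s x.
  apply/existsNP => all; apply: hX; exists (size s), (fun i => nth 0 s i) => x.
  by have [a xa] := lspan_coord s x (all x); exists (fun i => a i).
set p := dist (lspan s) in hp pD pZ pC *.
have p0 : 0 < p x.
  by rewrite lt_neqAle (seminorm_ge0 _ hp) andbT eq_sym; apply/eqP => /lspan_closed.
have [w sw xw] := @dist_adherent _ x (p x * e) hW.1 (mulr_gt0 p0 e0).
have pxw : p (x - w) = p x.
  have w0 : p w = 0 by exact: dist_mem.
  apply/le_anti; have := pD x (- w); have := pD (x - w) w.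
  by rewrite subrK (seminormN _ hp) w0 !addr0 => -> ->.
exists ((p x)^-1 *: (x - w)).
  by rewrite -/p (seminormZ _ _ hp) pxw gtr0_norm ?invr_gt0// mulVf ?gt_eqF.
rewrite normrZ gtr0_norm ?invr_gt0// ler_pdivrMl// mulrDr mulr1.
exact: ltW.
Qed.

End DistanceToSubspace.

(** * The flag of subspaces and the seminorms [N] and [S] *)

Section NearlyEqualSeminorms.
Context {R : realType} {X : normedModType R}.
Implicit Types (x : X) (k j m i : nat).

Lemma dist_antitone (V W : set X) x : V 0 -> V `<=` W -> dist W x <= dist V x.
Proof.
move=> V0 VW; apply/ler_addgt0Pr => e e0.
have [w Vw /ltW] := dist_adherent V x e V0 e0.
exact: le_trans (dist_le W x w (VW _ Vw)).
Qed.

(** Keeps only what is used of the flag: [d k] and [D] are the distances to [V_k] and to the union.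
    If [D x = 0], a point of the union close to [x] already lies in some [V_k], so [d k x] becomes
    small. *)
Lemma exists_flag (u : nat -> R) : infinite_dimensional X ->
  (forall k, 0 < u k) ->
  exists (d : nat -> X -> R) (D : X -> R) (z : nat -> X),
    [/\ forall k, bounded_seminorm 1 (d k), bounded_seminorm 1 D
      & forall x, d 0 x = `|x|] /\
    [/\ forall k x, d k.+1 x <= d k x, forall k x, D x <= d k x
      & forall x e, D x = 0 -> 0 < e -> exists k, d k x < e] /\
    [/\ forall k, d k.+1 (z k) = 0, forall k, d k (z k) = 1
      & forall k, `|z k| <= 1 + u k].
Proof.
move=> hX u0.
(* Choosing from the whole list of earlier vectors makes the recursion a plain iteration; its length
   gives the tolerance [u k] at stage [k]. *)
have /choice[pick pickP] : forall s : seq X, exists z,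
    dist (lspan s) z = 1 /\ `|z| <= 1 + u (size s).
  by move=> s; have [z] := riesz_lspan s (u (size s)) hX (u0 _); exists z.
pose L k := iter k (fun s => pick s :: s) [::].
pose V k := lspan (L k).
have VS k : linear_subspace (V k) by exact: lspan_subspace.
have VSn k : V k `<=` V k.+1.
  by move=> x Vx; exists 0; rewrite scale0r subr0.
have Vmono k m : (k <= m)%N -> V k `<=` V m.
  elim: m => [|m IH]; first by rewrite leqn0 => /eqP ->.
  by rewrite leq_eqVlt => /predU1P[->//|/IH km]; apply: subset_trans (VSn m).
have Vz k : V k.+1 (pick (L k)).
  by exists 1; rewrite scale1r subrr; have [] := VS k.
pose U := [set x | exists k, V k x].
have US : linear_subspace U.
  split; first by exists 0%N; have [] := VS 0%N.
  move=> t x y [k kx] [m my]; exists (maxn k m); have [_ VL] := VS (maxn k m).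
  by apply: VL; [apply: Vmono kx; rewrite leq_maxl | apply: Vmono my; rewrite leq_maxr].
have sizeL k : size (L k) = k by elim: k => //= k ->.
exists (fun k => dist (V k)), (dist U), (fun k => pick (L k)).
split; last split; split.
- by move=> k; exact: seminorm_dist_subspace.
- exact: seminorm_dist_subspace.
- move=> x; rewrite /dist /V /=; rewrite (_ : [set _ | _ in _] = [set `|x|]) ?inf1//.
  by apply/seteqP; split=> [_ [w -> <-]|_ ->]; rewrite /= ?subr0//; exists 0; rewrite ?subr0.
- by move=> k x; apply: dist_antitone => //; have [] := VS k.
- by move=> k x; apply: dist_antitone; [have [] := VS k | move=> y; exists k].
- move=> x e Dx e0; have [w [k Vw]] := dist_adherent U x e US.1 e0.
  rewrite Dx add0r => xw; exists k; exact: le_lt_trans (dist_le _ _ _ Vw) xw.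
- by move=> k; exact: dist_mem.
- by move=> k; have [] := pickP (L k).
- by move=> k; have [_] := pickP (L k); rewrite sizeL.
Qed.

(* The radius [r] has to be arbitrarily small because a convex function that is
   continuous at the origin is bounded only on a ball of uncontrolled size. *)
Lemma exists_nearly_equal_seminorms : infinite_dimensional X ->
  exists (N S : X -> R) (C : R),
    [/\ bounded_seminorm C N, bounded_seminorm C S,
        forall x, x != 0 -> S x < N x
      & forall r, 0 < r -> exists2 w : X, `|w| <= 2 &
          forall eps, 0 < eps -> exists e : X,
            [/\ `|e| <= r, 2^-1 <= `|w + e| & N (w + e) - S (w + e) < eps]].
Proof.
move=> hX; pose u k : R := 8^-1 * 4^-1 ^+ k.
have u_gt0 k : 0 < u k by rewrite mulr_gt0 ?exprn_gt0.
have uS k : u k.+1 = u k / 4 by rewrite /u exprSr mulrA.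
have u_anti k m : (k <= m)%N -> u m <= u k.
  elim: m => [|m IH]; first by rewrite leqn0 => /eqP ->.
  rewrite leq_eqVlt => /predU1P[->//|/IH km]; apply: le_trans km.
  by rewrite uS; have := u_gt0 m; lra.
have u_lt k m : (k < m)%N -> 4 * u m <= u k.
  by move=> /u_anti; rewrite uS; lra.
have u0 : u 0%N = 8^-1 by rewrite /u expr0 mulr1.
have u_le k : u k <= 8^-1 by rewrite -u0 u_anti.
have u_small r : 0 < r -> exists k, forall j, (k <= j)%N -> u j < r.
  move=> r0; have : 4^-1 ^+ n @[n --> \oo] --> (0 : R).
    by apply: cvg_expr; rewrite ger0_norm; lra.
  move=> /cvgrPdist_lt /(_ _ r0)[k _ kP]; exists k => j /kP.
  rewrite /= sub0r normrN ger0_norm ?exprn_ge0// /u.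
  have : 0 < 4^-1 ^+ j :> R by rewrite exprn_gt0.
  lra.
have [d [D [z [[hd hD d0] [[dS Dd Dlim] [dSz dz z_le]]]]]] := exists_flag u hX u_gt0.
have d_anti k m x : (k <= m)%N -> d m x <= d k x.
  elim: m => [|m IH]; first by rewrite leqn0 => /eqP ->.
  by rewrite leq_eqVlt => /predU1P[->//|/IH]; apply: le_trans.
have d_ge0 k x : 0 <= d k x by exact: seminorm_ge0 (hd k).
have D_ge0 x : 0 <= D x by exact: seminorm_ge0 hD.
have d_le k x : d k x <= `|x| by rewrite -d0 d_anti.
(* The floor [u k / 2 * |x|] keeps [F k] strictly above the terms of [S] with large [j] when all
   [d j x] tend to [0]. *)
pose F k x := (2 - 8 * u k) * d k x + 2 * u k * Num.max (d k.+1 x) (u k / 2 * `|x|).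
(* A pair [(k, m)] stands for the indices [k < j] with [j = k + m + 1]. *)
pose G (p : nat * nat) x := (1 - u (p.1 + p.2).+1) *
  ((2 - 8 * u p.1) * d p.1 x + 2 * u p.1 * d (p.1 + p.2).+1 x).
have hF k : bounded_seminorm 2 (F k).
  have := u_gt0 k; have := u_le k => ? ?.
  apply: (@seminorm_le _ _ ((2 - 8 * u k) * 1 + 2 * u k * 1)); first lra.
  apply: seminormD.
  - by apply: seminormM (hd k); lra.
  - apply: seminormM; [lra | apply: seminorm_max (hd _) _].
    apply: (@seminorm_le _ _ (u k / 2 * 1)); first by lra.
    by apply: seminormM seminorm_norm; lra.
have hG p : bounded_seminorm 2 (G p).
  case: p => k m; set j := (k + m).+1.
  have := u_gt0 k; have := u_le k; have := u_gt0 j; have := u_le j => ? ? ? ?.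
  apply: (@seminorm_le _ _ ((1 - u j) * ((2 - 8 * u k) * 1 + 2 * u k * 1))).
    nra.
  apply: seminormM; first by lra.
  by apply: seminormD; apply: seminormM (hd _); lra.
have hN := seminormD hD (seminorm_supf hF).
have hS := seminorm_supf hG.
have FN k x : F k x <= supf F x by exact: supf_ge hF.
have GS p x : G p x <= supf G x by exact: supf_ge hG.
have max_ge a b : a <= Num.max a b /\ b <= Num.max a b :> R.
  by rewrite !le_max !lexx orbT.
exists (fun x => D x + supf F x), (supf G), (1 + 2); split=> //.
- by apply: seminorm_le hS; lra.
- move=> x x0; have nx : 0 < `|x| by rewrite normr_gt0.
  (* Strictness must survive the supremum, hence a margin uniform in [p]. If [D x] is nonzero it is
     [D x] itself, since each [G p] is at most some [F k]. *)
  suff [dl dl0 GN] : exists2 dl, 0 < dl & forall p, G p x <= D x + supf F x - dl.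
    by rewrite (le_lt_trans (supf_le _ _ _ GN))// ltrBlDr ltrDl.
  have [Dx|Dx] := eqVneq (D x) 0; last first.
    exists (D x) => [|[k m]]; first by rewrite lt_neqAle eq_sym Dx D_ge0.
    rewrite addrAC subrr add0r; apply: le_trans (FN k x).
    rewrite /G /F /=; set j := (k + m).+1.
    have [dm _] := max_ge (d k.+1 x) (u k / 2 * `|x|).
    have dj : d j x <= d k.+1 x by rewrite d_anti// /j ltnS leq_addr.
    have := u_gt0 k; have := u_le k; have := u_gt0 j; have := u_le j => ? ? ? ?.
    set A := (2 - 8 * u k) * d k x + _.
    have A0 : 0 <= A by rewrite addr_ge0// mulr_ge0//; lra.
    apply: (@le_trans _ _ A); first by rewrite ler_piMl//; lra.
    by rewrite lerD2l ler_wpM2l//; [lra | exact: le_trans dm].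
  (* Three ranges of [(k, j)]. For [k >= J1], the term is at most [|x| / 2] while [F 0 x >= |x|].
     For [k < J1] and [j >= J2], the floor in [F k] wins. For [j < J2], the factor [1 - u j] gains
     at least [u J2 * |x|]. *)
  have [J1 J1P] := Dlim x (`|x| / 8) Dx (divr_gt0 nx (ltr0n _ 8)).
  have [J2 J2P] := Dlim x (u J1 / 4 * `|x|) Dx
    (mulr_gt0 (divr_gt0 (u_gt0 J1) (ltr0n _ 4)) nx).
  have F0 : `|x| <= supf F x.
    apply: le_trans (FN 0%N x); rewrite /F d0 u0.
    have [_] := max_ge (d 1%N x) (8^-1 / 2 * `|x|); lra.
  exists (Num.min (`|x| / 2) (Num.min (u J1 ^+ 2 / 2 * `|x|) (u J2 * `|x|))).
    by rewrite !lt_min !mulr_gt0 ?exprn_gt0.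
  rewrite Dx add0r => -[k m]; rewrite /G /=; set j := (k + m).+1.
  have := FN k x; rewrite /F.
  have [dm xm] := max_ge (d k.+1 x) (u k / 2 * `|x|).
  set M := Num.max (d k.+1 x) _ in dm xm *; move=> FM.
  have dj : d j x <= d k.+1 x by rewrite d_anti// /j ltnS leq_addr.
  set A := _ + 2 * u k * d j x.
  have := u_gt0 k; have := u_le k; have := u_gt0 j; have := u_le j => uj1 uj0 uk1 uk0.
  have A0 : 0 <= A by rewrite addr_ge0// mulr_ge0//; lra.
  have AG : (1 - u j) * A <= A by rewrite ler_piMl//; lra.
  rewrite lerBrDr -lerBrDl; have [J1k|kJ1] := leqP J1 k.
    rewrite ge_min; apply/orP; left.
    suff : A <= `|x| / 2 by lra.
    have dk := d_anti _ _ x J1k.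
    have : 2 * u k * d j x <= 2 * u k * d k x.
      by rewrite ler_wpM2l//; [lra | exact: le_trans dj (dS _ _)].
    have : 0 <= u k * d k x by rewrite mulr_ge0// ltW.
    rewrite /A; lra.
  rewrite ge_min; apply/orP; right; rewrite ge_min; apply/orP.
  have uJ1 := u_anti _ _ (ltnW kJ1).
  have [J2j|jJ2] := leqP J2 j; [left | right].
    have dj2 : d j x <= u k / 4 * `|x|.
      apply: le_trans (d_anti _ _ x J2j) _; apply: le_trans (ltW J2P) _.
      by rewrite ler_wpM2r//; lra.
    have h1 : 2 * u k * d j x <= 2 * u k * (u k / 4 * `|x|) by rewrite ler_wpM2l//; lra.
    have h2 : 2 * u k * (u k / 2 * `|x|) <= 2 * u k * M by rewrite ler_wpM2l//; lra.
    have h3 : u J1 ^+ 2 * `|x| <= u k ^+ 2 * `|x|.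
      by rewrite ler_wpM2r// ler_pXn2r// nnegrE ltW.
    rewrite /A in AG *; move: AG h1 h2 h3 FM; rewrite !expr2; lra.
  have uJ2 := u_anti _ _ (ltnW jJ2).
  have AF : A <= supf F x.
    apply: le_trans FM; rewrite lerD2l ler_wpM2l//; [lra | exact: le_trans dm].
  have h1 : (1 - u j) * A <= (1 - u j) * supf F x by rewrite ler_wpM2l//; lra.
  have h2 : u J2 * supf F x <= u j * supf F x by rewrite ler_wpM2r//; lra.
  have h3 : u J2 * `|x| <= u J2 * supf F x by rewrite ler_wpM2l// ltW.
  lra.
- move=> r r0; have [k /(_ k (leqnn _)) uk] := u_small (r / 2) (divr_gt0 r0 (ltr0n _ 2)).
  have uk0 := u_gt0 k; have uk1 := u_le k.
  exists (z k) => [|eps eps0]; first by have := z_le k; lra.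
  (* The gap [N - S] will be at most [6 * u j]: [5 * u j] from the factor [1 - u j], and [u j] from
     [F k]. *)
  have [J /(_ (k + J).+1)] := u_small (eps / 6) (divr_gt0 eps0 (ltr0n _ 6)).
  set j := (k + J).+1 => /(_ (leqW (leq_addl _ _))) uj.
  have kj : (k < j)%N by rewrite ltnS leq_addr.
  have uj0 := u_gt0 j; have ujk := u_lt _ _ kj.
  set y := z k + u k *: z j.
  have nz : `|u k *: z j| <= u k * (1 + u j).
    by rewrite normrZ gtr0_norm// ler_wpM2l// ltW.
  have nzk : u k * (1 + u j) <= 9 / 8 * u k by have := u_le j; nra.
  have ny : `|y| <= 1 + 17 / 8 * u k.
    have := ler_normD (z k) (u k *: z j); have := z_le k; rewrite -/y; lra.
  have dky : 1 - 9 / 8 * u k <= d k y.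
    by have := seminormB (z k) (u k *: z j) (hd k); rewrite dz -/y; lra.
  have dk1y : d k.+1 y <= u k * (1 + u j).
    have [dD _ _] := hd k.+1; have := dD (z k) (u k *: z j).
    by have := d_le k.+1 (u k *: z j); rewrite dSz -/y; lra.
  (* [z k] lies in [V_j], so only [u k *: z j] contributes, and [d j (z j) = 1]. *)
  have djy : u k <= d j y.
    have [dD _ _] := hd j; have := dD y (- z k).
    rewrite /y addrAC subrr add0r (seminormN _ (hd j)) (seminormZ _ _ (hd j)) dz.
    have := d_anti _ _ (z k) kj; rewrite dSz (gtr0_norm uk0); lra.
  have Dy : D y = 0.
    apply/le_anti; rewrite D_ge0 andbT; have [dD _ _] := hd j.+1.
    apply: le_trans (Dd j.+1 y) (le_trans (dD _ _) _).
    rewrite (seminormZ _ _ (hd _)) dSz mulr0 addr0 -(dSz k).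
    exact/d_anti/ltnW.
  exists (u k *: z j); rewrite -/y; split; first by lra.
    by have := d_le k y; lra.
  (* [A] is the common main term: [S] is at least [(1 - u j) * A] by the pair [(k, j)], and [N]
     exceeds [A] by at most [2 * u k ^+ 2 * u j]. *)
  rewrite Dy add0r; set A := (2 - 8 * u k) * d k y + 2 * u k * u k.
  have A1 : (2 - 8 * u k) * (1 - 9 / 8 * u k) <= A.
    rewrite /A -[leLHS]addr0 lerD//; last by rewrite !mulr_ge0// ltW.
    by rewrite ler_wpM2l//; lra.
  have A5 : A <= 5 by have := d_le k y; rewrite /A; nra.
  have SA : (1 - u j) * A <= supf G y.
    apply: le_trans (GS (k, J) y); rewrite /G /= -/j.
    rewrite ler_wpM2l ?lerD2l ?ler_wpM2l//; lra.
  have NA : supf F y <= A + 2 * u k * (u k * u j).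
    apply: supf_le => i; rewrite /F.
    have ui0 := u_gt0 i; have ui1 := u_le i.
    have max_le : Num.max (d i.+1 y) (u i / 2 * `|y|) <= `|y|.
      by rewrite ge_max d_le ler_piMl//; lra.
    (* [F k] is the dominant term. For [i > k], [d i y] is of order [u k]. For [i < k], the weights
       of [F i] add up to [2 - 6 * u i] with [u i >= 4 * u k], which outweighs the losses of order
       [u k] in [A]. *)
    have [ik|ki|->] := ltngtP i k; last first.
    + have : Num.max (d k.+1 y) (u k / 2 * `|y|) <= u k * (1 + u j).
        rewrite ge_max dk1y /=; nra.
      rewrite /A; set M := Num.max _ _ => hM.
      have : 2 * u k * M <= 2 * u k * (u k * (1 + u j)) by rewrite ler_wpM2l//; lra.
      lra.
    + have di := d_anti _ _ y ki; have uki := u_lt _ _ ki.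
      have := d_ge0 i y.
      set M := Num.max _ _ in max_le *; move=> di0.
      have hM : 2 * u i * M <= 2 * u i * 2 by rewrite ler_wpM2l//; lra.
      have : 0 <= u k * (u k * u j) by rewrite !mulr_ge0// ltW.
      nra.
    + have uik := u_lt _ _ ik; have di := d_le i y.
      set M := Num.max _ _ in max_le *.
      have h1 : (2 - 8 * u i) * d i y <= (2 - 8 * u i) * (1 + 17 / 8 * u k).
        by rewrite ler_wpM2l//; lra.
      have h2 : 2 * u i * M <= 2 * u i * (1 + 17 / 8 * u k).
        by rewrite ler_wpM2l//; lra.
      have : 0 <= u k * (u k * u j) by rewrite !mulr_ge0// ltW.
      nra.
  have : u j * A <= u j * 5 by rewrite ler_wpM2l// ltW.
  have : u k * (u k * u j) <= 1 / 2 * u j by nra.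
  lra.
Qed.

End NearlyEqualSeminorms.

(** * Convex functions and reciprocals of d.c. functions *)

Section DeltaConvexity.
Context {R : realType} {X : normedModType R}.
Implicit Types (A D : set X) (G H f : X -> R) (x y a : X).

Lemma convex_functionP D f : @convex_function R X D f <->
  forall t x y, 0 <= t -> t <= 1 -> D x -> D y ->
    f (t *: x + (1 - t) *: y) <= t * f x + (1 - t) * f y.
Proof.
split=> [cf t x y t0 t1 Dx Dy | cf t x y /set_mem Dx /set_mem Dy].
  by have := cf (Itv01 t0 t1) x y (mem_set Dx) (mem_set Dy).
exact: cf.
Qed.

Lemma convex_setP D : @convex_set R X D <->
  forall t x y, 0 <= t -> t <= 1 -> D x -> D y -> D (t *: x + (1 - t) *: y).
Proof.
split=> [cD t x y t0 t1 Dx Dy | cD x y t /set_mem Dx /set_mem Dy].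
  by have /set_mem := cD x y (Itv01 t0 t1) (mem_set Dx) (mem_set Dy).
by apply: mem_set; exact: cD.
Qed.

Lemma convex_functionD D f g : @convex_function R X D f ->
  @convex_function R X D g -> @convex_function R X D (fun x => f x + g x).
Proof.
move=> /convex_functionP cf /convex_functionP cg; apply/convex_functionP.
move=> t x y t0 t1 Dx Dy; have := cf _ _ _ t0 t1 Dx Dy.
by have := cg _ _ _ t0 t1 Dx Dy; lra.
Qed.

Lemma convex_function_max_cst D f c : @convex_function R X D f ->
  @convex_function R X D (fun x => Num.max (f x) c).
Proof.
move=> /convex_functionP cf; apply/convex_functionP => t x y t0 t1 Dx Dy.
have s0 : 0 <= 1 - t by rewrite subr_ge0.
have le_max_cst z : c <= Num.max (f z) c by rewrite le_max lexx orbT.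
rewrite ge_max; apply/andP; split.
  apply: le_trans (cf _ _ _ t0 t1 Dx Dy) _.
  by apply: lerD; rewrite ler_wpM2l// le_max lexx.
have := ler_wpM2l t0 (le_max_cst x); have := ler_wpM2l s0 (le_max_cst y).
lra.
Qed.

Lemma seminorm_convex C (p : X -> R) D a : bounded_seminorm C p ->
  @convex_function R X D (fun x => p (x - a)).
Proof.
move=> hp; have [pD pZ _] := hp; apply/convex_functionP => t x y t0 t1 _ _.
have -> : t *: x + (1 - t) *: y - a = t *: (x - a) + (1 - t) *: (y - a).
  rewrite !scalerBr addrACA -opprD -scalerDl (_ : t + (1 - t) = 1) ?scale1r//.
  by ring.
apply: le_trans (pD _ _) _.
by rewrite !(seminormZ _ _ hp) !ger0_norm// subr_ge0.
Qed.

Lemma seminorm_continuous C (p : X -> R) a : bounded_seminorm C p ->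
  continuous (fun x => p (x - a)).
Proof.
move=> hp x; apply/cvgrPdist_le => e e0.
have C1 : 0 < `|C| + 1 by rewrite ltr_wpDl.
near=> y; apply: le_trans (seminorm_dist _ _ hp) _.
rewrite opprB addrA subrK.
apply: (@le_trans _ _ ((`|C| + 1) * `|x - y|)).
  by rewrite ler_wpM2r//; have := ler_norm C; lra.
rewrite -ler_pdivlMl//; near: y.
by apply: cvgr_dist_le; [exact: cvg_id | rewrite mulr_gt0 ?invr_gt0].
Unshelve. all: by end_near.
Qed.

Lemma convex_ball c r : @convex_set R X (ball c r).
Proof.
apply/convex_setP => t x y t0 t1; rewrite -!ball_normE /= !(distrC c) => cx cy.
have /convex_functionP := @seminorm_convex _ _ setT c (@seminorm_norm R X).
move=> /(_ t x y t0 t1 I I).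
have : t * `|x - c| <= t * Num.max `|x - c| `|y - c| by rewrite ler_wpM2l// le_max lexx.
have : (1 - t) * `|y - c| <= (1 - t) * Num.max `|x - c| `|y - c|.
  by rewrite ler_wpM2l ?subr_ge0// le_max lexx orbT.
have : Num.max `|x - c| `|y - c| < r by rewrite gt_max cx cy.
lra.
Qed.

(* With [f = G - H], the function [1 / f + m^-2 * G] is convex since [1 / f] is
   the supremum of its tangents at the values [s] of [f], which have slopes
   [- s^-2 >= - m^-2]. *)
Lemma dc_on_inv D G H m : @convex_set R X D ->
  continuous G -> continuous H ->
  @convex_function R X D G -> @convex_function R X D H ->
  (forall x, G x - H x != 0) ->
  0 < m -> (forall x, D x -> m <= G x - H x) ->
  dc_on D (fun x => 1 / (G x - H x)).
Proof.
move=> /convex_setP cD cG cH /convex_functionP vG /convex_functionP vH f0 m0 fm.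
exists (fun x => 1 / (G x - H x) + m ^- 2 * G x), (fun x => m ^- 2 * G x).
have l0 : 0 < m ^- 2 by rewrite invr_gt0 exprn_gt0.
split; last by move=> x _; rewrite addrK.
- split; last first.
    apply: continuous_subspaceT => x; apply: cvgD; last first.
      by apply: cvgMr; exact: cG.
    apply: cvgMr; apply: cvgV; first exact: f0.
    by apply: cvgB; [exact: cG | exact: cH].
  apply/convex_functionP => t x y t0 t1 Dx Dy.
  have := vG t x y t0 t1 Dx Dy; have := vH t x y t0 t1 Dx Dy.
  have := fm _ (cD t x y t0 t1 Dx Dy).
  set p := t *: x + _; move=> sm hH hG; set s := G p - H p in sm *.
  have s0 : 0 < s by exact: lt_le_trans sm.
  have tangent v : 0 < v -> 1 / s - (v - s) * s ^- 2 <= 1 / v.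
    move=> v0; rewrite -subr_ge0.
    have -> : 1 / v - (1 / s - (v - s) * s ^- 2) = (v - s) ^+ 2 / (v * s ^+ 2).
      by field; rewrite !gt_eqF.
    by rewrite divr_ge0 ?sqr_ge0// mulr_ge0 ?sqr_ge0// ltW.
  have tx := ler_wpM2l t0 (tangent _ (lt_le_trans m0 (fm x Dx))).
  have s1 : 0 <= 1 - t by rewrite subr_ge0.
  have ty := ler_wpM2l s1 (tangent _ (lt_le_trans m0 (fm y Dy))).
  have sl : s ^- 2 <= m ^- 2 by rewrite lef_pV2 ?posrE ?exprn_gt0// ler_pXn2r// nnegrE ltW.
  have l1 : 0 < s ^- 2 by rewrite invr_gt0 exprn_gt0.
  (* After the tangent inequalities, the convexity defect of [G] has coefficient [m ^- 2 - s ^- 2]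
     and that of [H] has [s ^- 2], both nonnegative. *)
  have h1 : 0 <= (m ^- 2 - s ^- 2) * (t * G x + (1 - t) * G y - G p).
    by rewrite mulr_ge0// subr_ge0.
  have h2 : 0 <= s ^- 2 * (t * H x + (1 - t) * H y - H p).
    by rewrite mulr_ge0 ?subr_ge0// ltW.
  move: tx ty h1 h2; rewrite /s.
  set l := m ^- 2; set q := (G p - H p) ^- 2; set a := 1 / (G p - H p).
  set b := 1 / (G x - H x); set c := 1 / (G y - H y).
  lra.
- split; last by apply: continuous_subspaceT => x; apply: cvgMr; exact: cG.
  apply/convex_functionP => t x y t0 t1 Dx Dy.
  rewrite !(mulrCA _ (m ^- 2)) -mulrDr ler_wpM2l//; first exact: ltW.
  exact: vG.
Qed.

End DeltaConvexity.

(* [a + (w + e)] is the midpoint of [a + 2 w] and [a + 2 e], and the convex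
   function [g] of a decomposition [g - h] is bounded above near [a]; reflecting
   in [a] bounds [h] from below on bounded sets. *)
Lemma dc_on_bounded_near_midpoint {R : realType} {X : normedModType R}
    (A : set X) (phi : X -> R) (a : X) :
  open A -> @convex_set R X A -> A a -> dc_on A phi ->
  exists2 r, 0 < r & forall w, A (a + 2 *: w) ->
    exists M, forall e, `|e| <= r -> phi (a + (w + e)) <= M.
Proof.
move=> Aopen /convex_setP cA Aa [g [h [[/convex_functionP vg cg] [/convex_functionP vh ch] phiE]]].
have near_bounded (k : X -> R) : {within A, continuous k} ->
    \forall x \near a, k x <= k a + 1.
  rewrite continuous_open_subspace// => /(_ a (mem_set Aa)).
  move=> /cvgrPdist_le /(_ 1 ltr01); apply: filterS => x /=.
  by rewrite ler_distlC => /andP[].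
have /nbhs_ballP[rr /= rr0 rrP] :
    \forall x \near a, [/\ A x, g x <= g a + 1 & h x <= h a + 1].
  apply: filterS3 (open_nbhs_nbhs (conj Aopen Aa)) (near_bounded g cg)
    (near_bounded h ch) => x; exact: And3.
have {rrP}near_a v : `|v| < rr -> [/\ A (a + v), g (a + v) <= g a + 1 & h (a + v) <= h a + 1].
  by move=> vr; apply: rrP; rewrite -ball_normE /= opprD addNKr normrN.
have rr4 : 0 < rr / 4 by rewrite divr_gt0.
exists (rr / 4) => // w Aw.
(* Small enough that [tau *: (w + e)] has norm below [rr] for every admissible [e]. *)
pose tau := rr / (`|w| + rr / 4 + rr).
have K0 : 0 < `|w| + rr / 4 + rr by rewrite !(ltr_wpDl, addr_ge0)// ltW.
have tau0 : 0 < tau by rewrite divr_gt0.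
exists (2^-1 * g (a + 2 *: w) + 2^-1 * (g a + 1) - h a + tau^-1) => e er.
have [|Ae ge _] := near_a (2 *: e); first by rewrite normrZ ger0_norm//; lra.
have h2 : 1 - 2^-1 = 2^-1 :> R by lra.
have half0 : 0 <= 2^-1 :> R by lra.
have half1 : 2^-1 <= 1 :> R by lra.
have := vg _ _ _ half0 half1 Aw Ae; have := cA _ _ _ half0 half1 Aw Ae.
have -> : 2^-1 *: (a + 2 *: w) + (1 - 2^-1) *: (a + 2 *: e) = a + (w + e).
  rewrite h2 !scalerDr !scalerA mulVf ?pnatr_eq0// !scale1r addrACA -scalerDl.
  by rewrite (_ : 2^-1 + 2^-1 = 1) ?scale1r//; lra.
rewrite h2 => Ap gp; rewrite phiE//.
have hp : h a - tau^-1 <= h (a + (w + e)).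
  have [|Aq _ hq] := near_a (- (tau *: (w + e))).
    rewrite normrN normrZ gtr0_norm// /tau mulrAC ltr_pdivrMr// ltr_pM2l//.
    by have := ler_normD w e; lra.
  (* The weight for which [a] is the convex combination of [a + (w + e)] and
     [a - tau *: (w + e)]. *)
  pose t := tau / (1 + tau).
  have t1 : 0 < 1 + tau by lra.
  have tE : (1 - t) * tau = t by rewrite /t; field; rewrite gt_eqF.
  have t0 : 0 < t by rewrite divr_gt0.
  have tle1 : t <= 1 by rewrite ler_pdivrMr// mul1r; lra.
  have := vh t _ _ (ltW t0) tle1 Ap Aq.
  have -> : t *: (a + (w + e)) + (1 - t) *: (a - tau *: (w + e)) = a.
    rewrite !scalerDr addrACA -!scalerDr scalerN scalerA tE subrr addr0.
    by rewrite -scalerDl (_ : t + (1 - t) = 1) ?scale1r//; ring.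
  have tV : t * tau^-1 = 1 - t by rewrite /t; field; rewrite !gt_eqF.
  have : (1 - t) * h (a - tau *: (w + e)) <= (1 - t) * (h a + 1).
    by rewrite ler_wpM2l// subr_ge0.
  by move=> hq1 hq2; rewrite -(ler_pM2l t0) mulrBr tV; lra.
lra.
Qed.

(** * Transfer of [N - S] to the set [A] *)

Theorem corollary5p6 (R : realType) (X : normedModType R)
    (hX : infinite_dimensional X) (A : set X)
    (A0 : A !=set0) (Aopen : open A) (Aconvex : @convex_set R X A) :
  (exists f : X -> R,
      [/\ forall x : X, A x -> 0 < f x,
          dc_on A f &
          ~ dc_on A (fun x : X => 1 / f x)])
  /\
  (exists g : X -> R, locally_dc_on A g /\ ~ dc_on A g).
Proof.
have [a Aa] := A0; have /open_nbhs_nbhs/nbhs_ballP[rho /= rho0 rhoA] := conj Aopen Aa.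
have [N [S [C [hN hS SN close]]]] := exists_nearly_equal_seminorms hX.
(* With [|w| <= 2], the point [a + 2 *: (s *: w)] stays within [rho / 2] of [a], hence in [A]. *)
pose s := rho / 8; have s0 : 0 < s by rewrite divr_gt0.
(* The correction [Num.max |x - a| (s / 2) - |x - a|] is positive at [a] and vanishes once
   [|x - a| >= s / 2], in particular at [a + s *: (w + e)] since [|w + e| >= 1 / 2]. *)
pose G x := N (x - a) + Num.max `|x - a| (s / 2).
pose H x := S (x - a) + `|x - a|.
have norm_convex := @seminorm_convex R X _ _ _ a (@seminorm_norm R X).
have norm_cont := @seminorm_continuous R X _ _ a (@seminorm_norm R X).
have cG : continuous G.
  move=> x; apply: cvgD; first exact: (@seminorm_continuous R X C N a hN).
  by apply: (@continuous_max _ _ _ _ x); [exact: norm_cont | exact: cvg_cst].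
have cH : continuous H.
  by move=> x; apply: cvgD; [exact: (@seminorm_continuous R X C S a hS) | exact: norm_cont].
have vG D : @convex_function R X D G.
  apply: convex_functionD; first exact: seminorm_convex hN.
  exact: convex_function_max_cst (norm_convex D).
have vH D : @convex_function R X D H.
  by apply: convex_functionD; [exact: seminorm_convex hS | exact: norm_convex].
have f_gt0 x : 0 < G x - H x.
  rewrite subr_gt0 /G /H; have [->|xa] := eqVneq x a.
    rewrite subrr normr0 -(scale0r (0 : X)) (seminormZ _ _ hN) (seminormZ _ _ hS).
    by rewrite normr0 !mul0r !add0r lt_max divr_gt0// orbT.
  by rewrite ltr_leD ?SN ?subr_eq0// le_max lexx.
have f_dc D : dc_on D (fun x => G x - H x).
  by exists G, H; split=> //; split=> //; apply: continuous_subspaceT.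
have not_dc : ~ dc_on A (fun x => 1 / (G x - H x)).
  move=> /(dc_on_bounded_near_midpoint _ _ _ Aopen Aconvex Aa)[r r0 bounded].
  have [w w2 closew] := close (r / s) (divr_gt0 r0 s0).
  have inA v : `|v| < rho -> A (a + v).
    by move=> vr; apply: rhoA; rewrite -ball_normE /= opprD addNKr normrN.
  have [|M boundM] := bounded (s *: w).
    apply: inA; rewrite scalerA normrZ ger0_norm; rewrite /s in s0 *; nra.
  have M1 : 0 < `|M| + 1 by rewrite ltr_wpDl.
  have sM0 : 0 < s * (`|M| + 1) by rewrite mulr_gt0.
  (* This tolerance makes [s * (N - S)] smaller than [1 / (|M| + 1)], so its reciprocal exceeds
     [M]. *)
  have [|e [er we close_e]] := closew (s * (`|M| + 1))^-1; first by rewrite invr_gt0.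
  have hse : `|s *: e| <= r.
    by rewrite normrZ gtr0_norm// mulrC -ler_pdivlMr.
  have := boundM _ hse.
  have fE : G (a + (s *: w + s *: e)) - H (a + (s *: w + s *: e)) =
      s * (N (w + e) - S (w + e)).
    have av : a + (s *: w + s *: e) - a = s *: (w + e).
      by rewrite addrAC subrr add0r scalerDr.
    rewrite /G /H av (seminormZ _ _ hN) (seminormZ _ _ hS).
    rewrite (gtr0_norm s0) max_l; first by ring.
    by rewrite (seminormZ s _ seminorm_norm) gtr0_norm// ler_pM2l.
  apply/negP; rewrite -ltNge; apply: (@lt_trans _ _ (`|M| + 1)).
    by have := ler_norm M; lra.
  have f0 := f_gt0 (a + (s *: w + s *: e)); rewrite fE in f0 *.
  rewrite div1r -(invrK (`|M| + 1)) ltf_pV2 ?posrE ?invr_gt0//.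
  rewrite -ltr_pdivlMl//; apply: lt_le_trans close_e _.
  by rewrite invfM.
have f_cont : continuous (fun x => G x - H x).
  by move=> x; apply: cvgB; [exact: cG | exact: cH].
split.
  by exists (fun x => G x - H x); split=> // x _; exact: f_gt0.
exists (fun x => 1 / (G x - H x)); split=> // c Ac.
(* By continuity [G - H >= m] on a ball around [c], where [dc_on_inv] applies. *)
pose m := (G c - H c) / 2; have m0 : 0 < m by rewrite divr_gt0.
have /nbhs_ballP[r /= r0 rP] : \forall x \near c, m <= G x - H x.
  have /cvgrPdist_le /(_ m m0) := f_cont c; apply: filterS => x /=.
  by rewrite ler_distl /m => /andP[]; lra.
exists (ball c r); split; [exact: convex_ball | exact: nbhsx_ballx |].
apply: (@dc_on_inv R X (ball c r `&` A) G H m) => //.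
- apply/convex_setP => t x y t0 t1 [cx Ax] [cy Ay]; split.
    by move/convex_setP: (@convex_ball R X c r); apply.
  by move/convex_setP: Aconvex; apply.
- by move=> x; rewrite gt_eqF.
- by move=> x [/rP].
Qed.
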